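(* Let $d\geq 3$. There is a constant $C=C_d>0$, depending only on $d$, such that for every odd prime power $q$ and every $t\in\mathbb{F}_q\setminus\{0\}$: if $E\subset \mathbb{F}_q^d$ satisfies $|E|>Cq^{\lceil 2d/3\rceil}$, then the VC-dimension of the $t$-distance graph $G_t(E)$ is at least $3$.
   Context: For $x,y\in\mathbb{F}_q^d$ write $\|x-y\|=\sum_{i=1}^d (x_i-y_i)^2\in\mathbb{F}_q$. For $E\subset\mathbb{F}_q^d$ and $t\in\mathbb{F}_q$, the $t$-distance graph $G_t(E)$ is the graph with vertex set $E$ in which $x\sim y$ if and only if $\|x-y\|=t$. VC-dimension: if $V$ is a set and $\mathcal{H}\subset\{0,1\}^V$ is a family of functions, $\mathcal{H}$ shatters a finite set $S\subset V$ if $\{0,1\}^S=\{h|_S:h\in\mathcal{H}\}$; the VC-dimension of $\mathcal{H}$ is the largest $n$ such that $\mathcal{H}$ shatters some set of size $n$ (infinite if no such $n$ exists). For a graph $G$ with vertex set $V$, let $N(x)=\{y\in V:x\sim y\}$ and $N[x]=\{x\}\cup N(x)$ be the neighborhood and closed neighborhood of $x\in V$. The VC-dimension of the graph $G$ is the VC-dimension of the family $\{\mathbf{1}_{N[x]}:x\in V\}$ of indicator functions. *)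

(* Defs.v *)
From mathcomp Require Import all_boot all_algebra reals.
Import GRing.Theory Num.Theory.

Set Implicit Arguments.
Unset Strict Implicit.
Unset Printing Implicit Defensive.

Section VCDimension.
Variable V : finType.

Definition restrict (S : {set V}) (h : {ffun V -> bool}) :
  {ffun {x : V | x \in S} -> bool} := [ffun x => h (val x)].

Definition shatters (H : {set {ffun V -> bool}}) (S : {set V}) : bool :=
  [set restrict S h | h in H] == [set: {ffun {x : V | x \in S} -> bool}].

(* On a finite V the sizes of shattered sets are bounded by #|V|, so the
   infinite value does not occur.  A nonempty family always shatters set0;
   the maximum is 0 by convention when H = set0. *)
Definition VCdim (H : {set {ffun V -> bool}}) : nat :=
  \max_(S : {set V} | shatters H S) #|S|.

Definition neighborhood (e : rel V) (x : V) : {set V} := [set y | e x y].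

Definition closed_neighborhood (e : rel V) (x : V) : {set V} :=
  x |: neighborhood e x.

Definition indicator (A : {set V}) : {ffun V -> bool} := [ffun y => y \in A].

Definition graph_VCdim (e : rel V) : nat :=
  VCdim [set indicator (closed_neighborhood e x) | x : V].

End VCDimension.

Local Open Scope ring_scope.

Definition qnorm (F : finFieldType) (d : nat) (x : 'rV[F]_d) : F :=
  \sum_(i < d) x ord0 i ^+ 2.

(* The vertex set is E itself, as the subtype of its elements. *)
Definition distance_graph (F : finFieldType) (d : nat) (E : {set 'rV[F]_d})
    (t : F) : rel {x : 'rV[F]_d | x \in E} :=
  fun x y => qnorm (val x - val y) == t.

Arguments distance_graph {F d} E t _ _.

(* Main.v *)
(** Write q = |F|, N = |E|, s = ceil(2d/3), and let nu_r(x) be the number of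
    y in E at distance r from x.  Summed over all x in F^d and all r, the
    square nu_r(x)^2 counts the triples (x, y, z) with x on the bisecting
    hyperplane of y, z in E, so the total variance of nu around N/q is at most
    N q^d.  By Cauchy-Schwarz the number e_r of pairs of E at distance r
    differs from N^2/q by at most N q^(d/2), which suffices when
    2s >= d + 2, i.e. d >= 4.

    For d = 3 the variance of a single nu_r is needed.  Two spheres of radius r
    meet in at most q + 2 points unless the norm of the difference of their
    centres is 0 or 4r, in which case they meet in at most 2q; the number of
    such exceptional pairs of centres is e_0 + e_(4r), so the variance bound
    for the radius maximising e_r bootstraps to e_r <= 2 N^2/q for all r.

    Hence some y in E has at least N/(4q) neighbours, and for most pairs a, b
    of them the set C of common neighbours of a and b has more than q^(s-2)
    elements (for d = 3: at least 3, and a, b not exceptional).  Then C spans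
    a large affine space, and the points c at distance t from all of C lie in
    its orthogonal complement, so there are few of them.  This yields
    neighbours a, b, c of y, pairwise non-adjacent and of degree less than N/4,
    such that each two have a common neighbour not adjacent to the third: y,
    these common neighbours, a, b, c themselves and a far vertex cut out the
    eight subsets of {a, b, c}. *)

Require Import Defs.
From mathcomp Require Import all_boot all_order all_fingroup all_algebra reals.
From mathcomp Require Import zify ring lra cyclic mxabelem.
Import Order.TTheory GRing.Theory Num.Theory.

Set Implicit Arguments.
Unset Strict Implicit.
Unset Printing Implicit Defensive.

Local Open Scope ring_scope.

(** * The dot product *)

Section InnerProduct.
Variables (F : finFieldType) (d : nat).
Implicit Types (x y z u v w : 'rV[F]_d) (r c : F).

Definition dot u v : F := (u *m v^T) 0 0.

Lemma dotC u v : dot u v = dot v u.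
Proof. by rewrite /dot !mxE; apply: eq_bigr => i _; rewrite !mxE mulrC. Qed.

Lemma dotDl u v w : dot (u + v) w = dot u w + dot v w.
Proof. by rewrite /dot mulmxDl mxE. Qed.

Lemma dotNl u w : dot (- u) w = - dot u w.
Proof. by rewrite /dot mulNmx mxE. Qed.

Lemma dotZl c u w : dot (c *: u) w = c * dot u w.
Proof. by rewrite /dot -scalemxAl mxE. Qed.

Lemma dotDr u v w : dot w (u + v) = dot w u + dot w v.
Proof. by rewrite dotC dotDl !(dotC w). Qed.

Lemma dotNr u w : dot w (- u) = - dot w u.
Proof. by rewrite dotC dotNl (dotC w). Qed.

Lemma dotZr c u w : dot w (c *: u) = c * dot w u.
Proof. by rewrite dotC dotZl (dotC w). Qed.

Definition dotE := (dotDl, dotDr, dotNl, dotNr, dotZl, dotZr).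

Lemma qnorm_dot x : qnorm x = dot x x.
Proof. by rewrite /dot mxE; apply: eq_bigr => i _; rewrite mxE expr2. Qed.

Lemma qnormN x : qnorm (- x) = qnorm x.
Proof. by rewrite !qnorm_dot !dotE opprK. Qed.

Lemma qnormC x y : qnorm (x - y) = qnorm (y - x).
Proof. by rewrite -qnormN opprB. Qed.

Lemma qnormD x y : qnorm (x + y) = qnorm x + 2 * dot x y + qnorm y.
Proof. by rewrite !qnorm_dot !dotE (dotC y x); ring. Qed.

Lemma qnormZ c x : qnorm (c *: x) = c ^+ 2 * qnorm x.
Proof. by rewrite !qnorm_dot !dotE; ring. Qed.

Lemma sub_kermx_tr u w : (u <= kermx w^T)%MS = (dot u w == 0).
Proof.
apply/sub_kermxP/eqP => [e|e]; first by rewrite /dot e mxE.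
by apply/matrixP => i j; rewrite !ord1 -[LHS]/(dot u w) e mxE.
Qed.

Lemma card_orthogonal m (W : 'M[F]_(m, d)) :
  #|[set x : 'rV[F]_d | W *m x^T == 0]| = (#|F| ^ (d - \rank W))%N.
Proof.
rewrite -mxrank_tr -mxrank_ker -card_rowg; apply: eq_card => x.
rewrite inE mem_rowg; apply/eqP/sub_kermxP => e.
  by rewrite -[x]trmxK -trmx_mul e trmx0.
by rewrite -[W]trmxK -trmx_mul e trmx0.
Qed.

Lemma card_hyperplane w : w != 0 -> #|[set x : 'rV[F]_d | dot x w == 0]| = (#|F| ^ d.-1)%N.
Proof.
move=> w0; have := card_orthogonal w.
rewrite (_ : \rank w = 1%N) ?subn1; last by rewrite rank_rV w0.
move=> <-; apply: eq_card => x; rewrite !inE dotC.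
apply/eqP/eqP => [e|e]; last by rewrite /dot e mxE.
by apply/matrixP => i j; rewrite !ord1 -[LHS]/(dot w x) e mxE.
Qed.

Lemma card_affine_hyperplane_le w c :
  w != 0 -> (#|[set x : 'rV[F]_d | dot x w == c]| <= #|F| ^ d.-1)%N.
Proof.
move=> w0; case: (set_0Vmem [set x : 'rV[F]_d | dot x w == c]) => [->|[p]].
  by rewrite cards0.
rewrite inE => /eqP pc; rewrite -(card_hyperplane w0).
rewrite -(card_imset _ (addIr (- p))); apply/subset_leq_card/subsetP => y.
by case/imsetP => x; rewrite !inE => /eqP xc ->; rewrite !dotE xc pc subrr.
Qed.

End InnerProduct.

(** If [2 = 0], then [1] has additive order two, which divides [#|F|] by Lagrange. *)
Lemma odd_card_two_neq0 (F : finFieldType) : odd #|F| -> (2 : F) != 0.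
Proof.
move=> oF; apply/negP => /eqP two0.
suff o2 : #[1%R : F]%g = 2%N.
  have := @order_dvdG _ [set: F]%G 1%R (in_setT _).
  by rewrite o2 cardsT dvdn2 oF.
have d2 : (#[1%R : F]%g %| 2)%N by rewrite order_dvdn FinRing.zmodXgE two0.
have /primeP[_ /(_ _ d2)] : prime 2 by [].
by rewrite order_eq1 oner_eq0 => /eqP.
Qed.

(** * Counting pairs at a given distance *)

Section Counting.
Local Open Scope nat_scope.

Lemma card_set_in_sum (T : finType) (A : {set T}) (P : pred T) :
  #|[set x in A | P x]| = \sum_(x in A) P x.
Proof.
by rewrite -sum1dep_card big_mkcondr; apply: eq_bigr => x _; case: (P x).
Qed.

(** Double count of the paths y - x - z: by the middle vertex, then by the ordered pair of ends. *)
Lemma sum_degree_sqr (S T : finType) (A : {set S}) (B : {set T})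
    (e : S -> T -> bool) :
  \sum_(x in A) #|[set y in B | e x y]| ^ 2 =
  \sum_(y in B) \sum_(z in B) #|[set x in A | e x y && e x z]|.
Proof.
transitivity (\sum_(x in A) \sum_(y in B) \sum_(z in B) (e x y && e x z : nat)).
  apply: eq_bigr => x _; rewrite card_set_in_sum -mulnn big_distrlr /=.
  by apply: eq_bigr => y _; apply: eq_bigr => z _; rewrite mulnb.
rewrite exchange_big; apply: eq_bigr => y _.
rewrite exchange_big; apply: eq_bigr => z _.
by rewrite card_set_in_sum.
Qed.

End Counting.

(** Cauchy-Schwarz against the constant 1: the defect is half the sum of [(f x - f y) ^+ 2] over all
    pairs. *)
Lemma sqr_sum_le (R : realDomainType) (T : finType) (A : {set T}) (f : T -> R) :
  (\sum_(x in A) f x) ^+ 2 <= #|A|%:R * \sum_(x in A) f x ^+ 2.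
Proof.
have : 0 <= \sum_(x in A) \sum_(y in A) (f x - f y) ^+ 2.
  by apply: sumr_ge0 => x _; apply: sumr_ge0 => y _; rewrite sqr_ge0.
have -> : \sum_(x in A) \sum_(y in A) (f x - f y) ^+ 2 =
    2 * (#|A|%:R * (\sum_(x in A) f x ^+ 2) - (\sum_(x in A) f x) ^+ 2).
  transitivity (\sum_(x in A) (#|A|%:R * f x ^+ 2 + \sum_(y in A) f y ^+ 2 -
                               2 * (f x * \sum_(y in A) f y))).
    apply: eq_bigr => x _.
    under eq_bigr do rewrite sqrrB.
    rewrite !big_split /= sumrN sumr_const -[_ *+ #|_|]mulr_natl.
    rewrite [X in _ - X](_ : _ = 2 * (f x * \sum_(y in A) f y)); first by ring.
    rewrite !mulr_sumr; apply: eq_bigr => y _; ring.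
  rewrite !big_split /= sumrN sumr_const -mulr_sumr -mulr_sumr -mulr_suml.
  rewrite -[_ *+ #|_|]mulr_natl; ring.
by rewrite pmulr_rge0 ?ltr0n // subr_ge0.
Qed.

Lemma natzX (a n : nat) : (a ^ n)%N%:Z = a%:Z ^+ n.
Proof. by rewrite -natz natrX natz. Qed.

Lemma natz_sum (T : finType) (A : {pred T}) (f : T -> nat) :
  (\sum_(x in A) f x)%N%:Z = \sum_(x in A) (f x)%:Z.
Proof. by rewrite -natz natr_sum; apply: eq_bigr => x _; rewrite natz. Qed.

Lemma sum_deviation_sqr (T : finType) (A : {set T}) (f : T -> nat) (a b : int) :
  \sum_(x in A) (a * (f x)%:Z - b) ^+ 2 =
  a ^+ 2 * (\sum_(x in A) f x ^ 2)%N%:Z - 2 * a * b * (\sum_(x in A) f x)%N%:Z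
  + b ^+ 2 * #|A|%:Z.
Proof.
rewrite !natz_sum !mulr_sumr -sumrN.
have -> : b ^+ 2 * #|A|%:Z = \sum_(x in A) b ^+ 2.
  by rewrite sumr_const -[_ *+ _]mulr_natr natz.
rewrite -!big_split /=; apply: eq_bigr => x _; rewrite natzX; ring.
Qed.

Section Spheres.
Variables (F : finFieldType) (d : nat).
Implicit Types (x y z w : 'rV[F]_d) (E X : {set 'rV[F]_d}) (r : F).

Definition sphere r y := [set x : 'rV[F]_d | qnorm (x - y) == r].

Definition nbr E r x := [set y in E | qnorm (x - y) == r].

(** Ordered pairs are counted, so for [r = 0] the diagonal is included. *)
Definition pairs E r : nat := \sum_(x in E) #|nbr E r x|.

Lemma sum_nbr_radii E x : \sum_r #|nbr E r x| = #|E|.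
Proof.
under eq_bigr do rewrite card_set_in_sum.
rewrite exchange_big /= -sum1_card; apply: eq_bigr => y _.
by rewrite (bigD1 (qnorm (x - y))) //= eqxx big1 // => r /negbTE; rewrite eq_sym => ->.
Qed.

Lemma sum_nbr_points E r : \sum_(x in setT) #|nbr E r x| = (#|E| * #|sphere r 0|)%N.
Proof.
under eq_bigr do rewrite card_set_in_sum.
rewrite exchange_big /= -sum_nat_const; apply: eq_bigr => y _.
rewrite -card_set_in_sum -(card_imset _ (addIr (- y))); apply: eq_card => x.
rewrite !inE subr0; apply/imsetP/idP => [[z]|xr].
  by rewrite !inE => zr ->.
by exists (x + y); rewrite ?inE ?addrK.
Qed.

Lemma sum_nbr_sqr E r :
  (\sum_(x in setT) #|nbr E r x| ^ 2 =
   \sum_(y in E) \sum_(z in E) #|sphere r y :&: sphere r z|)%N.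
Proof.
rewrite sum_degree_sqr; apply: eq_bigr => y _; apply: eq_bigr => z _.
by apply: eq_card => x; rewrite !inE.
Qed.

(** Each point of the bisector lies on both spheres for exactly one radius. *)
Lemma sum_card_sphereI y z :
  \sum_r #|sphere r y :&: sphere r z| =
  #|[set x : 'rV[F]_d | qnorm (x - y) == qnorm (x - z)]|.
Proof.
rewrite -sum1dep_card.
transitivity (\sum_r \sum_(x : 'rV[F]_d)
  ((qnorm (x - y) == r) && (qnorm (x - z) == r) : nat))%N.
  apply: eq_bigr => r _; rewrite -sum1_card big_mkcond; apply: eq_bigr => x _.
  by rewrite !inE; case: (_ && _).
rewrite exchange_big [RHS]big_mkcond; apply: eq_bigr => x _.
rewrite (bigD1 (qnorm (x - y))) //= eqxx big1 ?addn0 //= => [|r].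
  by rewrite eq_sym; case: ifP.
by rewrite eq_sym => /negbTE ->.
Qed.

Hypothesis oddF : odd #|F|.

(** The term [qnorm x] cancels, so the condition is affine in [x]; odd characteristic permits the
    division by 2. *)
Lemma bisector_dot x y z :
  (qnorm (x - y) == qnorm (x - z)) = (dot x (y - z) == (qnorm y - qnorm z) / 2).
Proof.
have two0 := odd_card_two_neq0 oddF.
rewrite !qnormD !qnormN !dotE -subr_eq0.
rewrite -[RHS](inj_eq (mulfI two0)) -[RHS]subr_eq0.
by rewrite -[RHS](inj_eq oppr_inj) oppr0; congr (_ == 0); field.
Qed.

Lemma card_bisector_le y z : y != z ->
  (#|[set x : 'rV[F]_d | qnorm (x - y) == qnorm (x - z)]| <= #|F| ^ d.-1)%N.
Proof.
move=> yz; have yz0 : y - z != 0 by rewrite subr_eq0.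
apply: leq_trans (card_affine_hyperplane_le ((qnorm y - qnorm z) / 2) yz0).
by apply/subset_leq_card/subsetP => x; rewrite !inE bisector_dot.
Qed.

(* Summed over all radii, the intersections of two spheres fill exactly the
   bisector of their centres, so no quadric has to be counted. *)
Lemma sum_deviation_le E X r : (0 < d)%N ->
  \sum_(x in X) (#|F|%:Z * #|nbr E r x|%:Z - #|E|%:Z) ^+ 2
  <= #|E|%:Z * #|F|%:Z ^+ d.+2.
Proof.
move=> d0; set q := #|F|; set N := #|E|.
pose dev r x := (q%:Z * #|nbr E r x|%:Z - N%:Z) ^+ 2.
have dev_ge0 r' x : 0 <= dev r' x by rewrite sqr_ge0.
(* A pair y = z contributes at most the whole space, any other pair at most a hyperplane. *)
have tot : (\sum_r' \sum_(x in setT) #|nbr E r' x| ^ 2 <= N * q ^ d + N ^ 2 * q ^ d.-1)%N.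
  under eq_bigr do rewrite sum_nbr_sqr.
  rewrite exchange_big /=.
  apply: (@leq_trans (\sum_(y in E) (q ^ d + N * q ^ d.-1))%N); last first.
    by rewrite sum_nat_const mulnDr mulnA mulnn.
  apply: leq_sum => y yE; rewrite exchange_big /= (bigD1 y) //=; apply: leq_add.
    rewrite sum_card_sphereI; apply: leq_trans (max_card _) _.
    by rewrite card_mx mul1n.
  rewrite -sum_nat_const [leqRHS](bigD1 y) //=.
  apply: leq_trans (leq_addl _ _); apply: leq_sum => z /andP[_ zy].
  by rewrite sum_card_sphereI card_bisector_le // eq_sym.
(* All terms are squares, so passing from [X] to the whole space and from [r] to all radii only
   enlarges the sum. *)
apply: (@le_trans _ _ (\sum_r' \sum_(x in setT) dev r' x)).
  rewrite (bigD1 r) //= -[leLHS]addr0; apply: lerD; last first.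
    by apply: sumr_ge0 => r' _; apply: sumr_ge0.
  rewrite big_mkcond [leRHS]big_mkcond; apply: ler_sum => x _.
  by rewrite in_setT; case: ifP.
rewrite /dev; under eq_bigr do rewrite sum_deviation_sqr.
rewrite !big_split /= sumrN -!mulr_sumr.
rewrite -!natz_sum.
have -> : (\sum_r' \sum_(x in setT) #|nbr E r' x| = N * q ^ d)%N.
  rewrite exchange_big /=; under eq_bigr do rewrite sum_nbr_radii.
  by rewrite sum_nat_const cardsT card_mx mul1n mulnC.
rewrite sum_nat_const cardsT card_mx mul1n -/q.
move: tot; set T := (\sum_r' _)%N => tot.
have totZ : T%:Z <= N%:Z * q%:Z ^+ d + N%:Z ^+ 2 * q%:Z ^+ d.-1.
  by move: tot; rewrite -lez_nat PoszD !PoszM !natzX.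
rewrite !PoszM !natzX.
(* The terms N^2 q^(d+1) cancel: once from the pairs y != z, minus twice from the cross term, once
   from the constant. Only N q^(d+2) survives. *)
have := ler_wpM2l (sqr_ge0 q%:Z) totZ.
case: (d) d0 => // d' _; rewrite !exprS /= !expr0.
move: (q%:Z) (N%:Z) (T%:Z) => a b c {tot totZ T dev_ge0 dev}.
move: (a ^+ d') => Q; lra.
Qed.

End Spheres.

(** * Common neighbours *)

Section Bicliques.
Variables (F : finFieldType) (d : nat).
Hypothesis oddF : odd #|F|.
Implicit Types (x y z w : 'rV[F]_d) (E X C : {set 'rV[F]_d}) (r : F).

Lemma pairs_deviation_le X r : (0 < d)%N ->
  (#|F|%:Z * (pairs X r)%:Z - #|X|%:Z ^+ 2) ^+ 2
  <= #|X|%:Z ^+ 2 * #|F|%:Z ^+ d.+2.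
Proof.
move=> d0.
have -> : #|F|%:Z * (pairs X r)%:Z - #|X|%:Z ^+ 2 =
    \sum_(x in X) (#|F|%:Z * #|nbr X r x|%:Z - #|X|%:Z).
  by rewrite big_split /= sumrN -mulr_sumr -natz_sum sumr_const -[_ *+ _]mulr_natl natz.
apply: le_trans (sqr_sum_le _ _) _.
by rewrite natz expr2 -mulrA ler_wpM2l ?sum_deviation_le.
Qed.

(** For [y] in [C] this is the direction space of the affine span of [C]. *)
Definition shift_span C y := (\sum_(z in C) <<z - y>>)%MS.

Lemma card_le_shift_span C y : (#|C| <= #|F| ^ \rank (shift_span C y))%N.
Proof.
rewrite -card_rowg -(card_imset _ (addIr (- y))).
apply/subset_leq_card/subsetP => w /imsetP[z zC ->].
by rewrite mem_rowg (sumsmx_sup z) ?genmxE.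
Qed.

(** If x and p are both at distance r from y and z, subtracting the four equations leaves 2 (z -
    y).(x - p) = 0. So the solutions lie in a translate of the orthogonal complement of the span. *)
Lemma card_common_le C y r :  y \in C ->
  (#|[set x : 'rV[F]_d | [forall z in C, qnorm (z - x) == r]]|
   <= #|F| ^ (d - \rank (shift_span C y)))%N.
Proof.
move=> yC; set D := [set x | _].
have [->|[p pD]] := set_0Vmem D; first by rewrite cards0.
rewrite -card_orthogonal -(card_imset _ (addIr (- p))).
apply/subset_leq_card/subsetP => w /imsetP[x xD ->]; rewrite inE.
rewrite -[shift_span C y]trmxK -trmx_mul -trmx0 (inj_eq trmx_inj).
suff H : (shift_span C y <= kermx (x - p)^T)%MS.
  by rewrite -trmx_eq0 trmx_mul trmxK; apply/eqP/sub_kermxP.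
apply/sumsmx_subP => z zC; rewrite genmxE sub_kermx_tr.
have dist u v : u \in D -> v \in C -> qnorm (v - u) = r.
  by rewrite inE => /forall_inP H /H /eqP.
have /eqP: qnorm (z - p) - qnorm (z - x) - (qnorm (y - p) - qnorm (y - x)) = 0.
  by rewrite !dist // !subrr.
rewrite !qnormD !qnormN !dotE => e.
have two0 := odd_card_two_neq0 oddF.
by rewrite -(inj_eq (mulfI two0)) mulr0 -(eqP e); apply/eqP; ring.
Qed.

(** More than q^k points cannot lie in an affine space of dimension k, so the span has rank at least
    k + 1. *)
Lemma card_common_lt C y r k : y \in C -> (#|F| ^ k < #|C|)%N ->
  (#|[set x : 'rV[F]_d | [forall z in C, qnorm (z - x) == r]]|
   <= #|F| ^ (d - k.+1))%N.
Proof.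
move=> yC kC; apply: leq_trans (card_common_le _ yC) _.
have q1 := card_finNzRing_gt1 F.
rewrite leq_exp2l // leq_sub2l // -(ltn_exp2l _ _ q1).
exact: leq_trans kC (card_le_shift_span _ _).
Qed.

End Bicliques.

(** * Points on spheres *)

Lemma card_quadratic_le (F : finFieldType) (a b c : F) :
  a != 0 -> (#|[set x : F | a * x ^+ 2 + b * x + c == 0]%R| <= 2)%N.
Proof.
move=> a0; set D := [set x | _].
have [->|[x0]] := set_0Vmem D; first by rewrite cards0.
rewrite inE => /eqP e0.
(* By Vieta, the sum of the two roots is [- b / a]. *)
apply: (@leq_trans #|[set x0; - b / a - x0]|); last by rewrite cards2; case: (_ != _).
apply/subset_leq_card/subsetP => x; rewrite !inE => /eqP e.
have /eqP: (x - x0) * (a * (x - (- b / a - x0))) = 0.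
  by rewrite -[RHS](subrr 0) -{1}e -e0; field.
by rewrite !mulf_eq0 (negbTE a0) !subr_eq0.
Qed.

Section SpherePoints.
Variables (F : finFieldType) (d : nat).
Implicit Types (x y z u v w p : 'rV[F]_d) (r c : F).

Lemma card_line_sphere_le x y u r : qnorm u != 0 ->
  (#|[set c : F | (x - c *: u)%R \in sphere r y]| <= 2)%N.
Proof.
move=> u0.
apply: leq_trans (card_quadratic_le (- 2 * dot (x - y) u)%R (qnorm (x - y) - r)%R u0).
apply/subset_leq_card/subsetP => c; rewrite !inE => /eqP <-.
rewrite (addrAC x) (qnormD (x - y)) qnormN qnormZ dotNr dotZr.
by apply/eqP; ring.
Qed.

(** Count the pairs (x, c) with x in [P] and [x - c *: u] on the sphere: each c gives at least the
    size of the intersection, as [P] is invariant along [u], and each x gives at most two, being a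
    quadratic in c with leading coefficient [qnorm u]. *)
Lemma card_sphere_cylinder_le (P : {set 'rV[F]_d}) u y r :
  qnorm u != 0 -> (forall x c, x \in P -> x + c *: u \in P) ->
  (#|sphere r y :&: P| * #|F| <= 2 * #|P|)%N.
Proof.
move=> u0 Pu; set S := sphere r y.
apply: (@leq_trans (\sum_(c : F) #|[set x in P | (x - c *: u)%R \in S]|)).
  rewrite mulnC -sum_nat_const; apply: leq_sum => c _.
  rewrite -(card_imset _ (addIr (c *: u))); apply/subset_leq_card/subsetP => x.
  by case/imsetP => z; rewrite inE => /andP[zS zP] ->; rewrite inE Pu // addrK zS.
under eq_bigr do rewrite card_set_in_sum.
rewrite exchange_big mulnC -sum_nat_const; apply: leq_sum => x _ /=.
apply: leq_trans (card_line_sphere_le x y r u0).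
by rewrite -sum1dep_card [leqRHS]big_mkcond; apply: leq_sum => c _; case: (_ \in S).
Qed.

Lemma dot_delta w i : dot (delta_mx 0 i) w = w 0 i.
Proof.
rewrite /dot mxE (bigD1 i) //= big1 => [|j ji]; rewrite !mxE ?eqxx.
  by rewrite mul1r addr0.
by rewrite (negbTE ji) mul0r.
Qed.

End SpherePoints.

Section SpherePairs.
Variables (F : finFieldType) (d : nat).
Hypotheses (oddF : odd #|F|) (d3 : (3 <= d)%N).
Implicit Types (x y z u v w p : 'rV[F]_d) (r c : F).

(** The vectors w_j e_i - w_i e_j are orthogonal to [w] and have norm w_i^2 + w_j^2. If these norms
    vanish for all pairs out of three indices, then 2 w_i^2 = 0, against the choice of i. *)
Lemma orthogonal_anisotropic w : w != 0 -> exists2 u, dot u w = 0 & qnorm u != 0.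
Proof.
move=> w0; have two0 := odd_card_two_neq0 oddF.
pose g i j : 'rV[F]_d := w 0 j *: delta_mx 0 i - w 0 i *: delta_mx 0 j.
have gw i j : dot (g i j) w = 0.
  by rewrite !dotE !dot_delta mulrC subrr.
have gn i j : i != j -> qnorm (g i j) = w 0 i ^+ 2 + w 0 j ^+ 2.
  move=> ij; rewrite qnorm_dot /g !dotE !dot_delta !mxE !eqxx (negbTE ij).
  by rewrite eq_sym (negbTE ij) /=; ring.
have /existsP[i wi] : [exists i, w 0 i != 0].
  apply: contraNT w0; rewrite negb_exists => /forallP h.
  by apply/eqP/rowP => i; rewrite mxE; have /negPn/eqP := h i.
have [j [k [ij ik jk]]] : exists j k : 'I_d, [/\ i != j, i != k & j != k].
  have /card_gt1P[j [k [jD kD jk]]] : (1 < #|[set~ i]|)%N.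
    by rewrite cardsC1 card_ord; case: d d3 => [|[|[|]]].
  by exists j, k; move: jD kD; rewrite !inE ![_ == i]eq_sym.
have [a0|] := eqVneq (qnorm (g i j)) 0; last by exists (g i j).
have [b0|] := eqVneq (qnorm (g i k)) 0; last by exists (g i k).
have [c0|] := eqVneq (qnorm (g j k)) 0; last by exists (g j k).
rewrite !gn // in a0 b0 c0; case/negP: wi.
suff /eqP : 2 * w 0 i ^+ 2 = 0 by rewrite mulf_eq0 (negbTE two0) sqrf_eq0.
rewrite (_ : 2 * _ = (w 0 i ^+ 2 + w 0 j ^+ 2) + (w 0 i ^+ 2 + w 0 k ^+ 2) -
   (w 0 j ^+ 2 + w 0 k ^+ 2)); last by ring.
by rewrite a0 b0 c0; ring.
Qed.

Lemma card_sphere_le y r : (#|sphere r y| <= 2 * #|F| ^ d.-1)%N.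
Proof.
have [|u _ u0] := @orthogonal_anisotropic (delta_mx 0 (Ordinal (ltn_trans (ltn0Sn 1) d3))).
  apply/eqP => /rowP/(_ (Ordinal (ltn_trans (ltn0Sn 1) d3)))/eqP.
  by rewrite !mxE !eqxx oner_eq0.
have := @card_sphere_cylinder_le F d setT u y r u0 (fun _ _ _ => in_setT _).
rewrite setIT cardsT card_mx mul1n => H.
rewrite -(leq_pmul2r (ltnW (card_finNzRing_gt1 F))) -mulnA -expnSr prednK //.
exact: leq_trans d3.
Qed.

(** The intersection lies in the bisector, a cylinder along an anisotropic direction orthogonal to
    [y - z]. *)
Lemma card_sphereI_le y z r : y != z ->
  (#|sphere r y :&: sphere r z| <= 2 * #|F| ^ d.-2)%N.
Proof.
move=> yz; have [|u uw u0] := @orthogonal_anisotropic (y - z).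
  by rewrite subr_eq0.
pose P := [set x : 'rV[F]_d | qnorm (x - y) == qnorm (x - z)].
have := @card_sphere_cylinder_le F d P u y r u0.
have Pu x c : x \in P -> x + c *: u \in P.
  by rewrite !inE !bisector_dot // dotDl dotZl uw mulr0 addr0.
move=> /(_ Pu) H.
rewrite -(leq_pmul2r (ltnW (card_finNzRing_gt1 F))).
apply: (@leq_trans (#|sphere r y :&: P| * #|F|)).
  rewrite leq_mul2r subset_leq_card ?orbT //; apply/subsetP => x.
  by rewrite !inE => /andP[/eqP -> /eqP ->]; rewrite eqxx.
apply: leq_trans H _; rewrite -mulnA -expnSr leq_mul2l /=.
apply: leq_trans (card_bisector_le oddF yz) _.
by case: d d3 => [|[|]].
Qed.

End SpherePairs.

(** * Intersections of two spheres in dimension three *)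

Section ThreeSpace.
Variable F : finFieldType.
Hypothesis oddF : odd #|F|.
Implicit Types (x y z u v w p : 'rV[F]_3) (r c : F).

(* The quotient u^⊥ / u of an isotropic u is a line, so the Gram determinant
   of any two vectors orthogonal to u vanishes. *)
Lemma isotropic_gram u v w : u != 0 -> qnorm u = 0 -> dot v u = 0 ->
  dot w u = 0 -> qnorm v * qnorm w = dot v w ^+ 2.
Proof.
move=> u0 uu vu wu.
pose M : 'M[F]_(1 + (1 + 1), 3) := col_mx u (col_mx v w).
have e x : dot x u = 0 -> x *m u^T = 0.
  by move=> xu; apply/matrixP => i j; rewrite !ord1 -[LHS]/(dot x u) xu mxE.
have Mu : M *m u^T = 0 by rewrite /M !mul_col_mx !e // -?qnorm_dot // !col_mx0.
(* All rows of [M] are orthogonal to the nonzero [u], so [M] is singular and its rows satisfy a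
   linear relation. *)
have [a a0 aM] : exists2 a : 'rV[F]_(1 + (1 + 1)), a != 0 & a *m M = 0.
  apply/(@det0P F 3 M); rewrite -det_tr; apply/(@det0P F 3); exists u => //.
  by rewrite -[u]trmxK -trmx_mul Mu trmx0.
rewrite -[a]hsubmxK -[rsubmx a]hsubmxK in a0 aM.
move: (lsubmx a) (lsubmx (rsubmx a)) (rsubmx (rsubmx a)) a0 aM => a1 a2 a3.
rewrite /M !mul_row_col [a1]mx11_scalar [a2]mx11_scalar [a3]mx11_scalar.
rewrite !mul_scalar_mx; move: (a1 0 0) (a2 0 0) (a3 0 0) => {a1 a2 a3} {}a b c.
move=> abc0 comb.
have ev : b * qnorm v + c * dot v w = 0.
  have := congr1 (fun x => dot x v) comb; rewrite /= !dotE (dotC u) vu mulr0 add0r.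
  by rewrite -qnorm_dot (dotC w) => ->; rewrite /dot mul0mx mxE.
have ew : b * dot v w + c * qnorm w = 0.
  have := congr1 (fun x => dot x w) comb; rewrite /= !dotE (dotC u) wu mulr0 add0r.
  by rewrite -qnorm_dot => ->; rewrite /dot mul0mx mxE.
have /eqP bAG : b * (qnorm v * qnorm w - dot v w ^+ 2) = 0.
  rewrite (_ : _ * _ = qnorm w * (b * qnorm v + c * dot v w) -
    dot v w * (b * dot v w + c * qnorm w)); last by ring.
  by rewrite ev ew !mulr0 subrr.
have /eqP cAG : c * (qnorm v * qnorm w - dot v w ^+ 2) = 0.
  rewrite (_ : _ * _ = qnorm v * (b * dot v w + c * qnorm w) -
    dot v w * (b * qnorm v + c * dot v w)); last by ring.
  by rewrite ev ew !mulr0 subrr.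
apply/eqP; rewrite -subr_eq0; move: bAG cAG; rewrite !mulf_eq0.
have [b0|//] := eqVneq b 0; have [c0|//] := eqVneq c 0; exfalso; move: comb abc0.
rewrite b0 c0 !scale0r !addr0 => /eqP; rewrite scaler_eq0 (negbTE u0) orbF => /eqP->.
by rewrite raddf0 !row_mx0 eqxx.
Qed.

End ThreeSpace.

Section Conics.
Variable F : finFieldType.
Hypothesis oddF : odd #|F|.
Implicit Types (x y z u v w p : 'rV[F]_3) (r c : F).

(** An isotropic chord [u] is orthogonal to [p - y] and to [y - z]. As 2 (p - y).(y - z) = - |y -
    z|, the Gram identity for these two vectors becomes |y - z| (4r - |y - z|) = 0. *)
Lemma sphereI_chord_anisotropic y z p u r :
  qnorm (y - z) != 0 -> qnorm (y - z) != 4 * r -> u != 0 ->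
  p \in sphere r y :&: sphere r z -> p + u \in sphere r y :&: sphere r z ->
  qnorm u != 0.
Proof.
move=> n0 n4 u0; rewrite !inE => /andP[/eqP py /eqP pz] /andP[/eqP puy /eqP puz].
have two0 := odd_card_two_neq0 oddF.
apply/eqP => uu.
have tan x : qnorm (p - x) = r -> qnorm (p + u - x) = r -> dot (p - x) u = 0.
  move=> px; rewrite addrAC qnormD px uu => e.
  have /eqP : 2 * dot (p - x) u = 0 by rewrite -[RHS](subrr r) -{1}e; ring.
  by rewrite mulf_eq0 (negbTE two0) => /eqP.
have yz : dot (y - z) u = 0.
  have -> : y - z = (p - z) - (p - y) by rewrite opprB [RHS]addrC subrKA.
  by rewrite dotDl dotNl !tan // subrr.
have := isotropic_gram u0 uu (tan y py puy) yz; rewrite py => gram.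
have pd : 2 * dot (p - y) (y - z) = - qnorm (y - z).
  have := pz; rewrite -[p - z](subrKA y) (qnormD (p - y)) py => e.
  by rewrite -[RHS](addKr r) -{2}e; ring.
have /eqP: qnorm (y - z) * (4 * r - qnorm (y - z)) = 0.
  rewrite (_ : _ * _ = 4 * (r * qnorm (y - z)) - (- qnorm (y - z)) ^+ 2); last by ring.
  by rewrite gram -pd; ring.
by rewrite mulf_eq0 (negbTE n0) subr_eq0 eq_sym (negbTE n4).
Qed.

(** Along [p + c *: u] the sphere equation is a quadratic in [c] with leading coefficient
    [qnorm u != 0], and its roots are 0 and 1. *)
Lemma sphereI_chord_inj y z p u r c :
  qnorm (y - z) != 0 -> qnorm (y - z) != 4 * r -> u != 0 -> c != 0 ->
  p \in sphere r y :&: sphere r z -> p + u \in sphere r y :&: sphere r z ->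
  p + c *: u \in sphere r y :&: sphere r z -> c = 1.
Proof.
move=> n0 n4 u0 c0 pS puS; have := sphereI_chord_anisotropic n0 n4 u0 pS puS.
move: pS puS; rewrite !inE => /andP[/eqP py _] /andP[/eqP puy _] uu /andP[/eqP pcy _].
have e1 : 2 * dot (p - y) u + qnorm u = 0.
  by have := puy; rewrite addrAC qnormD py => e; rewrite -[RHS](subrr r) -{1}e; ring.
have e2 : 2 * dot (p - y) (c *: u) + qnorm (c *: u) = 0.
  by have := pcy; rewrite addrAC qnormD py => e; rewrite -[RHS](subrr r) -{1}e; ring.
have /eqP : c * qnorm u * (c - 1) = 0.
  rewrite (_ : _ * _ = 2 * dot (p - y) (c *: u) + qnorm (c *: u) -
    c * (2 * dot (p - y) u + qnorm u)); last by rewrite dotZr qnormZ; ring.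
  by rewrite e1 e2 mulr0 subrr.
by rewrite !mulf_eq0 (negbTE c0) (negbTE uu) subr_eq0 => /eqP.
Qed.

(** The chords from a fixed point p of the intersection are pairwise non-proportional and lie in the
    plane orthogonal to [y - z]. Their nonzero multiples are distinct, so (|S| - 1)(q - 1) <= q^2 -
    1. *)
Lemma card_conic_le y z r :
  qnorm (y - z) != 0 -> qnorm (y - z) != 4 * r ->
  (#|sphere r y :&: sphere r z| <= #|F| + 2)%N.
Proof.
move=> n0 n4; set S := _ :&: _.
have yz : y - z != 0.
  by apply: contraNneq n0 => ->; rewrite qnorm_dot /dot mul0mx mxE.
have [->|[p pS]] := set_0Vmem S; first by rewrite cards0.
rewrite (cardsD1 p) pS addnC addn2 addn1 ltnS.
pose f (a : 'rV[F]_3 * F) := a.2 *: (a.1 - p).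
have finj : {in setX (S :\ p) [set~ 0] &, injective f}.
  move=> [x a] [x' b]; rewrite !inE /f /= => /andP[/andP[xp xS] a0] /andP[/andP[x'p x'S] b0] e.
  have e' : x' - p = (a / b) *: (x - p).
    by rewrite mulrC -scalerA e scalerA mulVf // scale1r.
  have ab : a / b = 1.
    apply: (@sphereI_chord_inj y z p (x - p) r) => //.
    - by rewrite subr_eq0.
    - by rewrite mulf_neq0 ?invr_eq0.
    - by rewrite addrC subrK !inE.
    by rewrite -e' addrC subrK !inE.
  have -> : a = b by rewrite -[a](divfK b0) ab mul1r.
  by congr (_, _); apply/esym/(addIr (- p)); rewrite e' ab scale1r.
have := card_in_imset finj; rewrite cardsX cardsC1 => eq_card.
have : (f @: setX (S :\ p) [set~ 0] \subset [set x : 'rV[F]_3 | dot x (y - z) == 0] :\ 0).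
  apply/subsetP => w /imsetP[[x a]]; rewrite !inE /= => /andP[/andP[xp xS] a0] ->.
  rewrite /f /= scaler_eq0 (negbTE a0) subr_eq0 xp /= dotZl dotDl dotNl.
  move: xS pS; rewrite !inE => /andP[/eqP xy /eqP xz] /andP[/eqP py /eqP pz].
  have := bisector_dot oddF x y z; rewrite xy xz eqxx => /esym/eqP->.
  have := bisector_dot oddF p y z; rewrite py pz eqxx => /esym/eqP->.
  by rewrite subrr mulr0.
move=> /subset_leq_card; rewrite eq_card => {eq_card finj}.
have := card_hyperplane yz; rewrite (cardsD1 0) inE.
rewrite {1}/dot mul0mx mxE eqxx /= => card_w.
have q1 := card_finNzRing_gt1 F.
move: card_w; move: #|_ :\ 0| #|S :\ p| #|F| q1 => h m q q1 e le_mh.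
rewrite -(leq_pmul2r (_ : 0 < q.-1)%N); last by case: q q1 {e le_mh} => [|[]].
apply: leq_trans le_mh _; case: q q1 e => [//|q] _ /=; rewrite -mulnn; nia.
Qed.

End Conics.

(** * Lower bound for the size of a sphere in dimension three *)

Section SphereLowerBound.
Variable F : finFieldType.
Hypothesis oddF : odd #|F|.
Local Notation q := #|F|.

Lemma card_sqrt_le (c : F) : (#|[set x : F | x ^+ 2 == c]| <= 2)%N.
Proof.
apply: leq_trans (card_quadratic_le 0 (- c) (oner_neq0 F)).
apply/subset_leq_card/subsetP => x; rewrite !inE => /eqP ->.
by rewrite mul1r mul0r addr0 subrr.
Qed.

(** At least q/2 elements are squares. If the squares [A] and their reflection [c - A] were
    disjoint, q would be exactly 2 |A|, hence even. *)
Lemma two_squares (c : F) : exists a b : F, a ^+ 2 + b ^+ 2 = c.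
Proof.
pose A := [set x ^+ 2 | x in [set: F]].
have qA : (q <= 2 * #|A|)%N.
  rewrite -cardsT -sum1_card (partition_big_imset (fun x : F => x ^+ 2)) /=.
  rewrite mulnC -sum_nat_const; apply: leq_sum => a _.
  rewrite sum1dep_card; apply: leq_trans (card_sqrt_le a).
  by apply/subset_leq_card/subsetP => x; rewrite !inE.
pose B := [set c - a | a in A].
have cB : #|B| = #|A| by apply: card_imset => a b /addrI/oppr_inj.
have [AB0|[x]] := set_0Vmem (A :&: B).
  have := cardsUI A B; rewrite AB0 cards0 addn0 cB => e.
  have := max_card (A :|: B); rewrite e => qA'.
  have := oddF; rewrite (_ : q = #|A| + #|A|)%N ?addnn ?odd_double //.
  by apply/eqP; rewrite eqn_leq -{1}mul2n qA -addnn qA'.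
rewrite inE => /andP[/imsetP[a _ ->] /imsetP[_ /imsetP[b _ ->] e]].
by exists a, b; rewrite e subrK.
Qed.

Definition vec3 (a b c : F) : 'rV[F]_3 := \row_i [:: a; b; c]`_i.

Lemma qnorm_vec3 a b c : qnorm (vec3 a b c) = a ^+ 2 + b ^+ 2 + c ^+ 2.
Proof. by rewrite /qnorm !big_ord_recl big_ord0 !mxE /= addr0 addrA. Qed.

(* The slices of the sphere are circles; rotating one point of a circle by the
   rational parametrisation of the unit circle gives at least q - 2 others. *)
Lemma card_sphere3_ge (r : F) : ((q - 2) ^ 2 <= #|sphere r (0 : 'rV[F]_3)|)%N.
Proof.
have two0 := odd_card_two_neq0 oddF.
have ex2 c : exists p : F * F, p.1 ^+ 2 + p.2 ^+ 2 == c.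
  by have [a [b e]] := two_squares c; exists (a, b); apply/eqP.
pose f c := xchoose (ex2 c).
have fP c : (f c).1 ^+ 2 + (f c).2 ^+ 2 = c by apply/eqP/(xchooseP (ex2 c)).
(* [A] drops the slices whose circle has radius 0, [B] the parameters at which [1 + m ^+ 2]
   vanishes; each loses at most two elements. *)
pose A := [set c : F | c ^+ 2 != r]; pose B := [set m : F | m ^+ 2 != -1].
have card_ge s : (q - 2 <= #|[set x : F | x ^+ 2 != s]|)%N.
  rewrite leq_subLR -(cardsC [set x : F | x ^+ 2 == s]).
  apply: leq_add (card_sqrt_le s) _.
  by apply/subset_leq_card/subsetP => x; rewrite !inE.
apply: (@leq_trans #|setX A B|).
  by rewrite cardsX -mulnn leq_mul // card_ge.
pose g (t : F * F) := let p := f (r - t.1 ^+ 2) in let m := t.2 in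
  vec3 ((p.1 * (1 - m ^+ 2) - p.2 * (2 * m)) / (1 + m ^+ 2))
       ((p.1 * (2 * m) + p.2 * (1 - m ^+ 2)) / (1 + m ^+ 2)) t.1.
(* The parameter is recovered as the tangent of half the angle from p to v: the cross product over
   |p|^2 + p.v. *)
pose h (v : 'rV[F]_3) := let p := f (r - v 0 2 ^+ 2) in
  (v 0 2, (p.1 * v 0 1 - p.2 * v 0 0) /
          (p.1 ^+ 2 + p.2 ^+ 2 + p.1 * v 0 0 + p.2 * v 0 1)).
have gK : {in setX A B, cancel g h}.
  move=> [c m]; rewrite !inE /= => /andP[cr m1]; rewrite /h /g /vec3 !mxE /=.
  congr (_, _); move: (fP (r - c ^+ 2)); move: (f _) => [a b] /= e.
  have e0 : a ^+ 2 + b ^+ 2 != 0 by rewrite e subr_eq0 eq_sym.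
  have m0 : 1 + m ^+ 2 != 0 by rewrite addrC addr_eq0.
  field; rewrite m0 /= (_ : _ + _ + _ = 2 * (a ^+ 2 + b ^+ 2)); last by ring.
  by rewrite mulf_neq0.
rewrite -(card_in_imset (can_in_inj gK)); apply/subset_leq_card/subsetP => v.
case/imsetP => -[c m]; rewrite !inE /= => /andP[cr m1] ->.
rewrite subr0 /g qnorm_vec3 /=; have := fP (r - c ^+ 2); case: (f _) => a b /= e.
have m0 : 1 + m ^+ 2 != 0 by rewrite addrC addr_eq0.
apply/eqP; rewrite -[RHS](subrK (c ^+ 2)) -e; field.
exact: m0.
Qed.

End SphereLowerBound.

(** * Pairs at a given distance in dimension three *)

Section ThreeSpacePairs.
Variable F : finFieldType.
Hypothesis oddF : odd #|F|.
Implicit Types (x y z : 'rV[F]_3) (E : {set 'rV[F]_3}) (r : F).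
Local Notation q := #|F|.

(** The bounds for coinciding, generic and exceptional centres are added up, so that the sum over
    all pairs splits. *)
Lemma card_sphereI3_le y z r :
  (#|sphere r y :&: sphere r z| <= (y == z) * (2 * q ^ 2) + (q + 2) +
    2 * q * ((qnorm (y - z)%R == 0%R) + (qnorm (y - z)%R == (4 * r)%R)))%N.
Proof.
have [->|yz] := eqVneq y z.
  rewrite setIid mul1n -addnA.
  exact: leq_trans (card_sphere_le oddF (leqnn 3) z r) (leq_addr _ _).
rewrite mul0n add0n; have := card_sphereI_le oddF (leqnn 3) r yz.
rewrite expn1; case: eqP => [_|/eqP n0] H.
  by apply: leq_trans H _; rewrite mulnDr; lia.
case: eqP => [_|/eqP n4]; first by apply: leq_trans H _; lia.
by rewrite muln0 addn0 card_conic_le.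
Qed.

Lemma sum_card_sphereI3_le E r :
  (\sum_(y in E) \sum_(z in E) #|sphere r y :&: sphere r z| <=
   #|E| * (2 * q ^ 2) + #|E| ^ 2 * (q + 2) +
   2 * q * (pairs E 0%R + pairs E (4 * r)%R))%N.
Proof.
apply: (@leq_trans (\sum_(y in E) (2 * q ^ 2 + #|E| * (q + 2) +
  2 * q * (#|nbr E 0%R y| + #|nbr E (4 * r)%R y|)))%N); last first.
  rewrite big_split sum_nat_const -big_distrr big_split /=.
  by rewrite mulnDr (mulnA #|E| #|E|) mulnn.
apply: leq_sum => y yE.
apply: leq_trans (leq_sum _ (fun z _ => card_sphereI3_le y z r)) _.
rewrite !card_set_in_sum !big_split /= -big_distrl -big_distrr /= big_split /=.
rewrite [X in (X * _)%N](_ : _ = 1%N) ?mul1n ?sum_nat_const ?mulnDr //.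
by rewrite (bigD1 y) //= eqxx big1 // => z /andP[_]; rewrite eq_sym => /negbTE->.
Qed.

(** In the expanded variance the terms q^3 N^2 cancel. From q + 2 points per generic intersection
    and at least (q - 2)^2 per sphere remain 2 q^2 N^2 and 8 q^2 N^2, hence the 10. *)
Lemma pairs_deviation3_le E r :
  (q%:Z * (pairs E r)%:Z - #|E|%:Z ^+ 2) ^+ 2
  <= #|E|%:Z * (2 * q%:Z ^+ 4 * #|E|%:Z + 10 * q%:Z ^+ 2 * #|E|%:Z ^+ 2
     + 2 * q%:Z ^+ 3 * ((pairs E 0)%:Z + (pairs E (4 * r))%:Z)).
Proof.
have -> : q%:Z * (pairs E r)%:Z - #|E|%:Z ^+ 2 =
    \sum_(x in E) (q%:Z * #|nbr E r x|%:Z - #|E|%:Z).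
  by rewrite big_split /= sumrN -mulr_sumr -natz_sum sumr_const -[_ *+ _]mulr_natl natz.
apply: le_trans (sqr_sum_le _ _) _; rewrite [#|E|%:R]natz ler_wpM2l //.
apply: (@le_trans _ _ (\sum_(x in setT) (q%:Z * #|nbr E r x|%:Z - #|E|%:Z) ^+ 2)).
  rewrite big_mkcond [leRHS]big_mkcond; apply: ler_sum => x _.
  by rewrite in_setT; case: ifP; rewrite ?sqr_ge0.
rewrite sum_deviation_sqr sum_nbr_points sum_nbr_sqr cardsT card_mx mul1n natzX.
have := sum_card_sphereI3_le E r; have := card_sphere3_ge oddF r.
have := card_finNzRing_gt1 F.
move: #|sphere _ _| (\sum_(_ in _) _)%N (pairs E (4 * r)) (pairs E _) #|E| q => S T b a N p.
move=> p1 S_ge T_le.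
have {}S_ge : (p%:Z - 2) ^+ 2 <= S%:Z.
  by move: S_ge; rewrite -lez_nat natzX -subzn.
have {}T_le : T%:Z <= N%:Z * (2 * p%:Z ^+ 2) + N%:Z ^+ 2 * (p%:Z + 2) +
    2 * p%:Z * (a%:Z + b%:Z).
  by move: T_le; rewrite -lez_nat !(natzX, PoszD, PoszM).
have := ler_wpM2l (sqr_ge0 p%:Z) T_le.
have NN : 0 <= 2 * p%:Z * N%:Z ^+ 2 by rewrite mulr_ge0 ?sqr_ge0.
have := ler_wpM2l NN S_ge; have : 0 <= p%:Z * N%:Z ^+ 2 by rewrite mulr_ge0 ?sqr_ge0.
rewrite PoszM; move: S%:Z T%:Z a%:Z b%:Z N%:Z p%:Z {S_ge T_le NN} => S' T' a' b' N' p'.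
lra.
Qed.

Lemma pairs3_bounds E r : (100 * q ^ 2 <= #|E|)%N ->
  (q * pairs E r <= 2 * #|E| ^ 2)%N /\ (#|E| ^ 2 <= 2 * (q * pairs E r))%N.
Proof.
move=> Elarge; set N := #|E| in Elarge *.
pose a := q%:Z ^+ 2 * N%:Z; pose L := N%:Z ^+ 2; pose P s := q%:Z * (pairs E s)%:Z.
have dev s : (P s - L) ^+ 2 <= 2 * a ^+ 2 + 10 * a * L + 2 * a * (P 0 + P (4 * s)).
  apply: le_trans (pairs_deviation3_le E s) _; rewrite le_eqVlt; apply/orP; left; apply/eqP.
  rewrite /P /a /L -/N; move: (pairs E 0)%:Z (pairs E (4 * s))%:Z q%:Z N%:Z => u v p n; ring.
have a0 : 0 <= a by rewrite mulr_ge0 ?sqr_ge0.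
have aL : 100 * a <= L.
  have : 100 * q%:Z ^+ 2 <= N%:Z by move: Elarge; rewrite -lez_nat PoszM natzX.
  by move/(ler_wpM2r (le0z_nat N)); rewrite -mulrA.
have P0 s : 0 <= P s by rewrite mulr_ge0.
have Pmax s : P s <= 2 * L.
  (* At the maximising radius the right side of [dev] is bounded through [P m] itself. With
     [100 * a <= L], a value above [2 * L] is then contradictory. *)
  have [m _ Pm] := @arg_maxnP _ r predT (pairs E) isT.
  have le_m s' : P s' <= P m by rewrite ler_wpM2l // lez_nat; apply: Pm.
  apply: le_trans (le_m s) _; have := dev m; have := le_m 0; have := le_m (4 * m).
  move: (P m) (P0 m) (P 0) (P (4 * m)) => p p0 u v vp up dev_m.
  rewrite leNgt; apply/negP => Lp; nia.
(* With the upper bound inserted, the squared deviation is at most [2 * a ^+ 2 + 18 * a * L], which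
   is below L^2/4. *)
have : L <= 2 * P r.
  have := dev r; have := Pmax 0; have := Pmax (4 * r); have := P0 r.
  move: (P r) (P 0) (P (4 * r)) => p u v p0 vL uL dev_r.
  rewrite leNgt; apply/negP => Lp; nia.
by move=> LP; split; rewrite -lez_nat !(natzX, PoszM) ?LP ?Pmax.
Qed.

End ThreeSpacePairs.

(** * Shattering three points *)

Section Shattering.
Variables (V : finType) (e : rel V).

Lemma graph_VCdim_ge3 (a b c : V) : a != b -> a != c -> b != c ->
  (forall i j k : bool, exists v,
     [/\ (a \in closed_neighborhood e v) = i,
         (b \in closed_neighborhood e v) = j &
         (c \in closed_neighborhood e v) = k]) ->
  (3 <= graph_VCdim e)%N.
Proof.
move=> ab ac bc pat; pose S := a |: [set b; c].
have -> : 3%N = #|S| by rewrite cardsU1 cards2 !inE negb_or ab ac bc.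
apply: leq_bigmax_cond; apply/eqP/setP => f; rewrite in_setT.
have aS : a \in S by rewrite /S !inE eqxx.
have bS : b \in S by rewrite /S !inE eqxx /= orbT.
have cS : c \in S by rewrite /S !inE eqxx !orbT.
have [v [va vb vc]] := pat (f (Sub a aS)) (f (Sub b bS)) (f (Sub c cS)).
apply/imsetP; exists (indicator (closed_neighborhood e v)); first exact: imset_f.
apply/ffunP => -[x xS]; rewrite !ffunE /=.
have /or3P[/eqP e0|/eqP e0|/eqP e0] : [|| x == a, x == b | x == c].
  by move: xS; rewrite /S !inE.
- by move: xS; rewrite e0 va => xS; congr (f _); apply: val_inj.
- by move: xS; rewrite e0 vb => xS; congr (f _); apply: val_inj.
by move: xS; rewrite e0 vc => xS; congr (f _); apply: val_inj.
Qed.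

End Shattering.

Section Triples.
Local Open Scope nat_scope.

(** Union bound over the n^3 triples: three conditions on [B] and three on [K], each failing for at
    most n^3/6 triples, those on [B] for strictly fewer. *)
Lemma generic_triple (T : finType) (X : {set T}) (B : rel T)
    (K : T -> T -> {set T}) :
  6 * \sum_(a in X) \sum_(b in X) B a b < #|X| ^ 2 ->
  {in X &, forall a b, ~~ B a b -> 6 * #|K a b| <= #|X|} ->
  exists a b c, [/\ [&& a \in X, b \in X & c \in X],
    [&& ~~ B a b, ~~ B a c & ~~ B b c] &
    [&& c \notin K a b, b \notin K a c & a \notin K b c]].
Proof.
move=> smallB smallK; set n := #|X| in smallB smallK.
(* Pairs in [B] are left out, since [K] is only controlled off [B]. *)
pose D a b c : nat := ~~ B a b && (c \in K a b).
have [/existsP[a /existsP[b /existsP[c /and3P[]]]]|none] := boolP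
  [exists a, exists b, exists c, [&& [&& a \in X, b \in X & c \in X],
    [&& ~~ B a b, ~~ B a c & ~~ B b c] &
    [&& c \notin K a b, b \notin K a c & a \notin K b c]]].
  by exists a, b, c.
have sumD : {in X &, forall a b, 6 * \sum_(c in X) D a b c <= n}.
  move=> a b aX bX; have [Bab|nB] := boolP (B a b).
    by rewrite big1 // => c _; rewrite /D Bab.
  apply: leq_trans (smallK a b aX bX nB); rewrite leq_mul2l /=.
  rewrite -card_set_in_sum; apply/subset_leq_card/subsetP => c.
  by rewrite inE nB => /andP[].
have sumDD : 6 * \sum_(a in X) \sum_(b in X) \sum_(c in X) D a b c <= n ^ 3.
  rewrite expnSr -mulnn -mulnA -sum_nat_const big_distrr; apply: leq_sum => a aX.
  rewrite -sum_nat_const big_distrr; apply: leq_sum => b bX.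
  exact: sumD.
have: n ^ 3 <= \sum_(a in X) \sum_(b in X) \sum_(c in X)
    (B a b + B a c + B b c + D a b c + D a c b + D b c a).
  rewrite expnSr -mulnn -mulnA -sum_nat_const; apply: leq_sum => a aX.
  rewrite -sum_nat_const; apply: leq_sum => b bX.
  rewrite /n -sum1_card; apply: leq_sum => c cX.
  move: none; rewrite negb_exists => /forallP/(_ a); rewrite negb_exists.
  move/forallP/(_ b); rewrite negb_exists => /forallP/(_ c).
  rewrite aX bX cX /D /=.
  by do 3!case: (B _ _) => //=; do 3!case: (_ \in K _ _).
rewrite leqNgt => /negP[].
set beta := \sum_(a in X) _ in smallB.
have -> : \sum_(a in X) \sum_(b in X) \sum_(c in X)
    (B a b + B a c + B b c + D a b c + D a c b + D b c a) =
    3 * (n * beta) + 3 * \sum_(a in X) \sum_(b in X) \sum_(c in X) D a b c.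
  under eq_bigr do (under eq_bigr do rewrite !big_split /=; rewrite !big_split /=).
  rewrite !big_split /=.
  have e1 : \sum_(a in X) \sum_(b in X) \sum_(c in X) B a b = n * beta.
    under eq_bigr do (under eq_bigr do rewrite sum_nat_const; rewrite -big_distrr).
    by rewrite -big_distrr.
  have e2 : \sum_(a in X) \sum_(b in X) \sum_(c in X) B a c = n * beta.
    by under eq_bigr do rewrite sum_nat_const; rewrite -big_distrr.
  have e3 : \sum_(a in X) \sum_(b in X) \sum_(c in X) B b c = n * beta.
    by rewrite sum_nat_const.
  have e4 : \sum_(a in X) \sum_(b in X) \sum_(c in X) D a c b =
            \sum_(a in X) \sum_(b in X) \sum_(c in X) D a b c.
    by apply: eq_bigr => a _; rewrite exchange_big.
  have e5 : \sum_(a in X) \sum_(b in X) \sum_(c in X) D b c a =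
            \sum_(a in X) \sum_(b in X) \sum_(c in X) D a b c.
    by rewrite exchange_big; apply: eq_bigr => a _; rewrite exchange_big.
  by rewrite e1 e2 e3 e4 e5; lia.
move: smallB sumDD; set s := \sum_(a in X) _; rewrite -mulnn; nia.
Qed.

End Triples.

Section Assembly.
Variables (F : finFieldType) (d : nat) (E : {set 'rV[F]_d}) (t : F).
Implicit Types (x y z a b c : 'rV[F]_d) (P : rel 'rV[F]_d).
Local Notation q := #|F|.
Local Notation N := #|E|.
Local Open Scope nat_scope.

Lemma nbrC x y : y \in E -> x \in nbr E t y -> y \in nbr E t x.
Proof. by rewrite !inE qnormC => -> /andP[]. Qed.

Lemma sum_nbr_pairs P :
  \sum_(y in E) \sum_(a in nbr E t y) \sum_(b in nbr E t y) P a b =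
  \sum_(a in E) \sum_(b in E) P a b * #|nbr E t a :&: nbr E t b|.
Proof.
transitivity (\sum_(y in E) \sum_(a in E) \sum_(b in E)
   (y \in nbr E t a :&: nbr E t b) * P a b).
  apply: eq_bigr => y yE; rewrite [LHS]big_mkcond [RHS]big_mkcond /=.
  apply: eq_bigr => a _; rewrite !inE (qnormC y).
  case: (a \in E) => //=; case: eqP => [ya|/eqP/negbTE ya]; last first.
    by rewrite big1 // => b _; rewrite !inE yE ya.
  rewrite [LHS]big_mkcond [RHS]big_mkcond /=.
  apply: eq_bigr => b _; rewrite !inE yE ya eqxx (qnormC y) /=.
  by case: (b \in E); case: (_ == _); rewrite ?mul1n.
rewrite exchange_big; apply: eq_bigr => a aE.
rewrite exchange_big; apply: eq_bigr => b bE.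
rewrite -big_distrl mulnC -card_set_in_sum; congr (_ * _).
by apply: eq_card => y; rewrite !inE; case: (y \in E).
Qed.

(** If no y works, each degree n satisfies 16 q^2 n^2 <= 1024 q^2 s + N^2, with s the number of
    pairs in [P]. Summed over y, the left side is at least 4 N^3 by Cauchy-Schwarz and the right
    side is below 3 N^3 + N^3. *)
Lemma exists_center P : N ^ 2 <= 2 * (q * pairs E t) ->
  1024 * q ^ 2 * \sum_(a in E) \sum_(b in E) P a b * #|nbr E t a :&: nbr E t b|
    < 3 * N ^ 3 ->
  exists2 y, y \in E & N <= 4 * q * #|nbr E t y| /\
    64 * \sum_(a in nbr E t y) \sum_(b in nbr E t y) P a b <= #|nbr E t y| ^ 2.
Proof.
rewrite -sum_nbr_pairs; pose n y := #|nbr E t y|.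
pose s y := \sum_(a in nbr E t y) \sum_(b in nbr E t y) P a b.
rewrite -/(pairs E t) => Elarge smallP.
have [/existsP[y /and3P[yE y1 y2]]|none] := boolP
  [exists y, [&& y \in E, N <= 4 * q * n y & 64 * s y <= n y ^ 2]].
  by exists y.
have each y : y \in E -> 16 * q ^ 2 * n y ^ 2 <= 1024 * q ^ 2 * s y + N ^ 2.
  move=> yE; move: none; rewrite negb_exists => /forallP/(_ y).
  rewrite yE /= negb_and -!ltnNge => /orP[lt|lt].
    apply: leq_trans (leq_addl _ _); rewrite (_ : 16 * _ * _ = (4 * q * n y) ^ 2).
      by rewrite leq_sqr ltnW.
    by rewrite !expnMn.
  apply: leq_trans (leq_addr _ _).
  have -> : 1024 * q ^ 2 * s y = 16 * q ^ 2 * (64 * s y).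
    by move: (q ^ 2) (s y) => u v; lia.
  by rewrite leq_mul2l (ltnW lt) orbT.
have /= := leq_sum (index_enum _) each.
rewrite -!big_distrr big_split /= -big_distrr sum_nat_const /=.
have : pairs E t ^ 2 <= N * \sum_(y in E) n y ^ 2.
  have := sqr_sum_le E (fun y => (n y)%:Z).
  under [X in (_ <= _ * X)%R]eq_bigr do rewrite -natzX.
  by rewrite natz -!natz_sum -natzX -PoszM lez_nat.
move: Elarge smallP.
move: (pairs E t) (\sum_(y in E) n y ^ 2) (\sum_(y in E) _) N q => e S B m p.
move=> large smallB CS tot; exfalso.
have m0 : 0 < m by case: m smallB {large CS tot} => //; rewrite muln0.
have m3 : m ^ 3 <= 4 * p ^ 2 * S.
  rewrite -(leq_pmul2l m0) -expnS.
  apply: (@leq_trans ((2 * (p * e)) ^ 2)); first by rewrite (expnM m 2 2) leq_sqr.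
  rewrite !expnMn mulnA mulnCA leq_mul2l; apply/orP; right.
  exact: CS.
have : m * m ^ 2 = m ^ 3 by rewrite -expnS.
move: m3 tot smallB; move: (m ^ 3) (p ^ 2) => u v m3 tot smallB e3.
rewrite e3 in tot; have : 16 * v * S = 4 * (4 * v * S) by lia.
lia.
Qed.

Lemma VCdim_from_center P y : y \in E ->
  64 * \sum_(a in nbr E t y) \sum_(b in nbr E t y) P a b <= #|nbr E t y| ^ 2 ->
  64 * pairs (nbr E t y) t <= #|nbr E t y| ^ 2 ->
  64 * #|[set x in E | N <= 4 * #|nbr E t x|]| <= #|nbr E t y| ->
  64 <= #|nbr E t y| ->
  {in nbr E t y &, forall a b, ~~ P a b ->
    6 * #|[set c : 'rV[F]_d | [forall z in nbr E t a :&: nbr E t b, qnorm (z - c)%R == t]]|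
    <= #|nbr E t y|} ->
  3 <= graph_VCdim (distance_graph E t).
Proof.
move=> yE; set X := nbr E t y; set n := #|X|; set H := [set x in E | _].
move=> smallP small_adj smallH n64 smallK.
pose B a b := [|| P a b, qnorm (a - b)%R == t, a == b, a \in H | b \in H].
(* Each of the five conditions in [B] accounts for at most n^2/64 pairs, and 6 * 5 < 64. *)
have smallB : 6 * \sum_(a in X) \sum_(b in X) B a b < n ^ 2.
  have leH : \sum_(a in X) (a \in H) <= #|H|.
    rewrite -card_set_in_sum; apply/subset_leq_card/subsetP => x.
    by rewrite inE => /andP[].
  have : \sum_(a in X) \sum_(b in X) B a b <=
    \sum_(a in X) \sum_(b in X) P a b + pairs X t + n + n * #|H| + n * #|H|.
    have -> : pairs X t = \sum_(a in X) \sum_(b in X) (qnorm (a - b)%R == t).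
      by apply: eq_bigr => a _; rewrite card_set_in_sum.
    apply: (@leq_trans (\sum_(a in X) \sum_(b in X) (P a b + (qnorm (a - b)%R == t) +
      (a == b) + (a \in H) + (b \in H)))).
      apply: leq_sum => a _; apply: leq_sum => b _; rewrite /B.
      by case: (P a b); case: (_ == t); case: (a == b); case: (a \in H); case: (b \in H).
    under eq_bigr do rewrite !big_split /=.
    rewrite !big_split /=; apply: leq_add; first apply: leq_add; first apply: leq_add.
    - by [].
    - rewrite /n -sum1_card; apply: leq_sum => a aX.
      by rewrite (bigD1 a) //= eqxx big1 // => b /andP[_]; rewrite eq_sym => /negbTE->.
    - under eq_bigr do rewrite sum_nat_const.
      by rewrite -big_distrr leq_mul2l leH orbT.
    by rewrite sum_nat_const leq_mul2l leH orbT.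
  move: smallP small_adj smallH n64; rewrite -/X -/n.
  move: (\sum_(a in X) _) (pairs X t) (\sum_(a in X) _) #|H| n {smallK} => p e b h m.
  rewrite -mulnn; nia.
pose K a b := [set c : 'rV[F]_d |
  [forall z in nbr E t a :&: nbr E t b, qnorm (z - c)%R == t]].
have smallKB : {in X &, forall a b, ~~ B a b -> 6 * #|K a b| <= n}.
  by move=> a b aX bX; rewrite negb_or => /andP[Pab _]; apply: smallK.
have [a [b [c [/and3P[aX bX cX] /and3P[nab nac nbc] /and3P[cK bK aK]]]]] :=
  generic_triple smallB smallKB.
have XE x : x \in X -> x \in E by rewrite inE => /andP[].
have witness u v w : w \notin K u v ->
    exists z, [/\ z \in E, qnorm (z - u)%R = t, qnorm (z - v)%R = t & qnorm (z - w)%R != t].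
  rewrite inE negb_forall => /existsP[z]; rewrite negb_imply !inE.
  move=> /andP[/andP[/andP[zE /eqP zu] /andP[_ /eqP zv]] zw].
  by exists z; rewrite zE -qnormC zu -qnormC zv.
have good u v : u \in X -> v \in X -> ~~ B u v ->
    [/\ qnorm (u - v)%R != t, u != v, 4 * #|nbr E t u| < N & 4 * #|nbr E t v| < N].
  move=> uX vX; rewrite !negb_or => /and5P[_ -> ->].
  by rewrite !inE (XE u) ?(XE v) //= -!ltnNge => -> ->.
have [adj_ab ab a4 b4] := good a b aX bX nab.
have [adj_ac ac _ c4] := good a c aX cX nac.
have [adj_bc bc _ _] := good b c bX cX nbc.
(* Three vertices and three neighbourhoods of size below N/4 cannot cover [E], as N >= 64. *)
have isolated : exists z, [/\ z \in E, z \notin [set a; b; c] &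
    z \notin nbr E t a :|: nbr E t b :|: nbr E t c].
  pose U := [set a; b; c] :|: (nbr E t a :|: nbr E t b :|: nbr E t c).
  have : 0 < #|E :\: U|.
    rewrite -(ltn_add2l #|E :&: U|) cardsID addn0.
    have N64 : 64 <= N.
      apply: leq_trans n64 _; apply/subset_leq_card/subsetP => x.
      exact: XE.
    apply: (@leq_ltn_trans (3 + (#|nbr E t a| + #|nbr E t b| + #|nbr E t c|))).
      apply: leq_trans (subset_leq_card (subsetIr _ _)) _.
      apply: leq_trans (leq_card_setU _ _) _; apply: leq_add.
        apply: leq_trans (leq_card_setU _ _) _; rewrite cards1 cards2.
        by case: (_ != _).
      apply: leq_trans (leq_card_setU _ _) _; rewrite leq_add2r.
      exact: leq_card_setU.
    move: a4 b4 c4 N64; move: #|nbr E t a| #|nbr E t b| #|nbr E t c| #|E|.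
    by clear; lia.
  case/card_gt0P => z; rewrite in_setD in_setU negb_or => /andP[/andP[z1 z2] zE].
  by exists z.
pose V := {x : 'rV[F]_d | x \in E}.
have mem_nbhd (u : 'rV[F]_d) (uE : u \in E) (v : V) :
    ((exist _ u uE : V) \in closed_neighborhood (distance_graph E t) v) =
    (u == val v) || (qnorm (val v - u)%R == t).
  by rewrite !inE.
have aE := XE a aX; have bE := XE b bX; have cE := XE c cX.
apply: (@graph_VCdim_ge3 _ _ (exist _ a aE) (exist _ b bE) (exist _ c cE)) => // i j k.
suff [z zE [za zb zc]] : exists2 z, z \in E & [/\
    (a == z) || (qnorm (z - a)%R == t) = i, (b == z) || (qnorm (z - b)%R == t) = j &
    (c == z) || (qnorm (z - c)%R == t) = k].
  by exists (exist _ z zE); rewrite !mem_nbhd.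
have hub u : u \in X -> (u == y) || (qnorm (y - u)%R == t).
  by rewrite inE => /andP[_ ->]; rewrite orbT.
have apart u v : qnorm (u - v)%R != t -> u != v ->
    (u == v) || (qnorm (v - u)%R == t) = false.
  by move=> uv u_v; rewrite (negbTE u_v) qnormC (negbTE uv).
have apartC u v : qnorm (u - v)%R != t -> u != v ->
    (v == u) || (qnorm (u - v)%R == t) = false.
  by move=> uv u_v; rewrite eq_sym (negbTE u_v) (negbTE uv).
(* Closed neighbourhoods also require z != w, which holds because z is adjacent to u and w is
   not. *)
have pairwise u w z : qnorm (z - u)%R = t -> qnorm (z - w)%R != t ->
    qnorm (u - w)%R != t -> (w == z) || (qnorm (z - w)%R == t) = false.
  move=> zu zw uw; rewrite (negbTE zw) orbF; apply/negP => /eqP wz.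
  by move: uw; rewrite wz qnormC zu eqxx.
case: i j k => [] [] [].
- by exists y => //; rewrite !hub.
- have [z [zE za zb zc]] := witness a b c cK.
  exists z => //; rewrite za zb eqxx !orbT; split=> //.
  exact: pairwise za zc adj_ac.
- have [z [zE za zc zb]] := witness a c b bK.
  exists z => //; rewrite za zc eqxx !orbT; split=> //.
  exact: pairwise za zb adj_ab.
- by exists a => //; rewrite eqxx !apartC.
- have [z [zE zb zc za]] := witness b c a aK.
  exists z => //; rewrite zb zc eqxx !orbT; split=> //.
  by apply: pairwise zb za _; rewrite qnormC.
- by exists b => //; rewrite eqxx apart ?apartC.
- by exists c => //; rewrite eqxx !apart.
have [z [zE z1 z2]] := isolated; exists z => //.
move: z1 z2; rewrite !inE !negb_or zE /= => /andP[/andP[/negbTE za /negbTE zb] /negbTE zc].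
move=> /andP[/andP[na nb] nc]; rewrite ![_ == z]eq_sym za zb zc !(qnormC z).
by rewrite (negbTE na) (negbTE nb) (negbTE nc).
Qed.

End Assembly.

(** * Quantitative bounds *)

Lemma int_sqr_le (x y : int) : 0 <= y -> x ^+ 2 <= y ^+ 2 -> x <= y.
Proof. by move=> y0 xy; rewrite leNgt; apply/negP => ltyx; nia. Qed.

Section Counts.
Variables (F : finFieldType) (d : nat) (E : {set 'rV[F]_d}) (t : F).
Hypotheses (oddF : odd #|F|) (d0 : (0 < d)%N) (q128 : (128 <= #|F|)%N).
Implicit Types (x y z a b c : 'rV[F]_d).
Local Notation q := #|F|.
Local Notation N := #|E|.

(** Chebyshev: a degree v >= N/4 gives q v - N >= q N / 8, so |H| (q N)^2 / 64 is at most the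
    variance bound N q^(d+2). *)
Lemma card_high_degree_le :
  (#|[set x in E | N <= 4 * #|nbr E t x|]%N| * N <= 64 * q ^ d)%N.
Proof.
set H := [set x in E | _].
have [E0|N0] := posnP N; first by rewrite E0 muln0.
have : (#|H| * (N * q) ^ 2 <= 64 * (N * q ^ d.+2))%N.
  rewrite -lez_nat !(natzX, PoszM).
  have := sum_deviation_le oddF E H t d0; rewrite -(ler_pM2l (_ : (0 : int) < 64)) //.
  apply: le_trans; rewrite mulr_sumr -[#|H|%:Z]natz mulr_natl -sumr_const.
  apply: ler_sum => x; rewrite inE => /andP[_ high].
  move: high q128 N0; move: #|nbr E t x| #|E| #|F| => v n p high p128 n0.
  have h : n%:Z * p%:Z <= 8 * (p%:Z * v%:Z - n%:Z).
    have h1 : (p * n <= p * (4 * v))%N by rewrite leq_mul2l high orbT.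
    have h2 : (128 * n <= p * n)%N by rewrite leq_mul2r p128 orbT.
    move: h1 h2; clear; lia.
  have np0 : 0 <= n%:Z * p%:Z by rewrite mulr_ge0.
  move: h np0; move: (n%:Z * p%:Z) (p%:Z * v%:Z - n%:Z) => g k h g0.
  have -> : 64 * k ^+ 2 = (8 * k) ^+ 2 by ring.
  by rewrite lerXn2r ?nnegrE ?(le_trans g0 h).
have q0 : (0 < q)%N by apply: leq_trans q128.
move=> hN; rewrite -(leq_pmul2l (_ : 0 < N * q ^ 2)%N); last by rewrite muln_gt0 N0 expn_gt0 q0.
move: hN; rewrite -(addn2 d) expnD -!mulnn.
move: #|F| #|E| (q ^ d)%N #|H|; clear => p n D h hn.
have -> : (n * (p * p) * (h * n) = h * (n * p * (n * p)))%N by ring.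
by have -> : (n * (p * p) * (64 * D) = 64 * (n * (D * (p * p))))%N by ring.
Qed.

(** Here 64 |H| <= 64 * 64 q^d / N, and this is at most N/(4q) by the first hypothesis, as 2^14 = 64
    * 64 * 4. *)
Lemma high_degree_small y : (2 ^ 14 * q ^ d.+1 <= N ^ 2)%N -> (N <= 4 * q * #|nbr E t y|)%N ->
  (64 * #|[set x in E | N <= 4 * #|nbr E t x|]%N| <= #|nbr E t y|)%N.
Proof.
move=> large deg_y; have := card_high_degree_le.
move: #|[set _ in _ | _]| #|nbr E t y| deg_y => h n deg_y hN.
have q0 : (0 < q)%N by apply: leq_trans q128.
have N0 : (0 < N)%N.
  by rewrite -sqrn_gt0; apply: leq_trans large; rewrite muln_gt0 !expn_gt0 q0.
rewrite -(leq_pmul2r (_ : 0 < 4 * q * N)%N); last by rewrite !muln_gt0 q0 N0.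
apply: (@leq_trans (N ^ 2)); last by rewrite -mulnn; nia.
apply: leq_trans large.
have -> : (64 * h * (4 * q * N) = 2 ^ 8 * (q * (h * N)))%N by ring.
rewrite (expnS q) (expnD 2 8 6); move: (q ^ d)%N hN => D hN.
have -> : (2 ^ 8 * 2 ^ 6 * (q * D) = 2 ^ 8 * (q * (64 * D)))%N by ring.
by rewrite !leq_mul2l hN !orbT.
Qed.

Lemma pairs_large : (4 * q ^ d.+2 <= N ^ 2)%N -> (N ^ 2 <= 2 * (q * pairs E t))%N.
Proof.
move=> large; have := pairs_deviation_le oddF E t d0.
have : 4 * q%:Z ^+ d.+2 <= N%:Z ^+ 2 by move: large; rewrite -lez_nat !(natzX, PoszM).
rewrite -lez_nat natzX !PoszM; move: (q%:Z ^+ d.+2) (q%:Z * (pairs E t)%:Z).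
have: 0 <= N%:Z ^+ 2 by rewrite sqr_ge0.
move: (N%:Z ^+ 2) => m m0 k w km dev.
have : m - w <= w; last by lia.
have : 2 * (m - w) <= m; last by lia.
apply: int_sqr_le => //; nia.
Qed.

(** The deviation is at most |X|^2 / 2^10 after division by q, and the mean |X|^2 / q is at most
    |X|^2 / 128; together this is below |X|^2 / 64. *)
Lemma pairs_small (X : {set 'rV[F]_d}) : (2 ^ 20 * q ^ d <= #|X| ^ 2)%N ->
  (64 * pairs X t <= #|X| ^ 2)%N.
Proof.
move=> large; have := pairs_deviation_le oddF X t d0.
have : 2 ^+ 20 * q%:Z ^+ d <= #|X|%:Z ^+ 2 by move: large; rewrite -lez_nat !(natzX, PoszM).
have : 128 <= q%:Z by [].
rewrite -lez_nat natzX !PoszM -(addn2 d) exprD.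
have: 0 <= #|X|%:Z ^+ 2 by rewrite sqr_ge0.
have: 0 <= q%:Z by [].
have: 0 <= q%:Z ^+ d by rewrite exprn_ge0.
move: (pairs X t)%:Z (#|X|%:Z ^+ 2) q%:Z (q%:Z ^+ d) => e m p D D0 p0 m0 p128 Dm dev.
have h : 2 ^+ 10 * (p * e - m) <= p * m.
  apply: int_sqr_le; first by rewrite mulr_ge0.
  have -> : (2 ^+ 10 * (p * e - m)) ^+ 2 = 2 ^+ 20 * (p * e - m) ^+ 2 by ring.
  apply: le_trans (ler_wpM2l _ dev) _; first by rewrite exprn_ge0.
  have -> : 2 ^+ 20 * (m * (D * p ^+ 2)) = p ^+ 2 * m * (2 ^+ 20 * D) by ring.
  have -> : (p * m) ^+ 2 = p ^+ 2 * m * m by ring.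
  by rewrite ler_wpM2l ?mulr_ge0 ?sqr_ge0.
rewrite leNgt; apply/negP => me; move: h; apply/negP; rewrite -ltNge.
have -> : 2 ^+ 10 = 1024%Z :> int by [].
nia.
Qed.

End Counts.

(** * The case 2s >= d + 2, which covers dimension at least four *)

Section LargeDimension.
Variables (F : finFieldType) (d s : nat) (E : {set 'rV[F]_d}) (t : F).
Hypotheses (oddF : odd #|F|) (q128 : (128 <= #|F|)%N).
Hypotheses (s2 : (2 <= s)%N) (sd : (d.+2 <= 2 * s)%N).
Local Notation q := #|F|.
Local Notation N := #|E|.

Lemma VCdim_large_dimension : (0 < d)%N -> (2 ^ 12 * q ^ s <= N)%N ->
  (3 <= graph_VCdim (distance_graph E t))%N.
Proof.
move=> d0 large.
have q0 : (0 < q)%N by apply: leq_trans q128.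
have N0 : (0 < N)%N by apply: leq_trans large; rewrite muln_gt0 !expn_gt0 q0.
have large2 : (2 ^ 24 * q ^ d.+2 <= N ^ 2)%N.
  apply: (@leq_trans ((2 ^ 12 * q ^ s) ^ 2)); last by rewrite leq_sqr.
  by rewrite expnMn -!expnM leq_mul2l leq_pexp2l ?(mulnC s) ?orbT.
(* Pairs with few common neighbours contribute at most N^2 q^(s-2) to the sum in [exists_center],
   and 2^10 q^s N^2 <= N^3. *)
pose P : rel 'rV[F]_d := fun a b => (#|nbr E t a :&: nbr E t b| <= q ^ (s - 2))%N.
have edges : (N ^ 2 <= 2 * (q * pairs E t))%N.
  apply: pairs_large => //; apply: leq_trans large2.
  by apply: leq_mul => //; apply: (@leq_pexp2l 2 2 24).
have [|y yE [deg_y smallP]] := @exists_center F d E t P edges.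
  apply: (@leq_ltn_trans (1024 * q ^ 2 * (N * (N * q ^ (s - 2))))).
    rewrite leq_mul2l -sum_nat_const; apply/orP; right.
    apply: leq_sum => a _; rewrite -sum_nat_const; apply: leq_sum => b _.
    by have [Pab|//] := boolP (P a b); rewrite mul1n.
  rewrite (_ : _ * _ = N ^ 2 * (2 ^ 10 * q ^ s))%N; last first.
    rewrite -{2}(subnK s2) expnD; move: (q ^ 2)%N (q ^ (s - 2))%N N; clear.
    by move=> a b n; rewrite -mulnn (_ : 1024 = 2 ^ 10)%N //; ring.
  rewrite (expnSr N 2) [ltnRHS]mulnCA ltn_mul2l expn_gt0 N0 /=.
  apply: (@leq_trans N.+1); last by case: N N0 => // m _; lia.
  rewrite ltnS; apply: leq_trans large.
  by apply: leq_mul => //; apply: (@leq_pexp2l 2 10 12).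
set n := #|nbr E t y| in deg_y smallP.
(* The factor 4 lost from 2^12 leaves 2^10, whose square is the constant of [pairs_small]. *)
have n_large : (2 ^ 10 * q ^ s.-1 <= n)%N.
  rewrite -(leq_pmul2l (_ : 0 < 4 * q)%N) ?muln_gt0 ?q0 //.
  apply: leq_trans deg_y; apply: leq_trans large.
  have -> : (q ^ s = q * q ^ s.-1)%N by rewrite -expnS prednK // ltnW.
  rewrite (expnD 2 2 10); apply/eq_leq.
  by move: (2 ^ 10)%N (q ^ s.-1)%N => a b; ring.
apply: (@VCdim_from_center F d E t P y yE smallP).
- apply: pairs_small => //; rewrite -/n.
  apply: (@leq_trans ((2 ^ 10 * q ^ s.-1) ^ 2)); last by rewrite leq_sqr.
  rewrite expnMn -!expnM leq_mul2l leq_pexp2l ?orbT //.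
  by move: s2 sd; clear; lia.
- apply: high_degree_small => //; apply: leq_trans large2.
  apply: leq_mul; first by rewrite leq_exp2l.
  by rewrite leq_pexp2l.
- apply: leq_trans n_large; apply: (@leq_trans (2 ^ 10 * 1)) => //.
  by rewrite leq_mul2l expn_gt0 q0 orbT.
(* More than q^(s-2) common neighbours leave at most q^(d-s+1) points, and d - s + 1 <= s - 1. *)
move=> a b aX bX; rewrite /P -ltnNge => codeg.
have yC : y \in nbr E t a :&: nbr E t b by rewrite inE (nbrC yE aX) (nbrC yE bX).
apply: leq_trans (leq_mul (leqnn 6) (card_common_lt oddF t yC codeg)) _.
apply: leq_trans n_large; apply: leq_mul; first by apply: (@leq_trans (2 ^ 10)).
by rewrite leq_pexp2l //; move: s2 sd; clear; lia.
Qed.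

End LargeDimension.

(** * The case of dimension three *)

Section DimensionThree.
Variables (F : finFieldType) (E : {set 'rV[F]_3}) (t : F).
Hypotheses (oddF : odd #|F|) (q128 : (128 <= #|F|)%N) (t0 : t != 0).
Local Notation q := #|F|.
Local Notation N := #|E|.
Implicit Types (a b y z : 'rV[F]_3).

(** Three points of [C] are not collinear: on a line through y, [sphereI_chord_inj] forces z1 = z2.
    So the span has rank at least 2 and its complement at most q elements. *)
Lemma card_common3_le a b y (C := nbr E t a :&: nbr E t b) :
  qnorm (a - b) != 0 -> qnorm (a - b) != 4 * t -> y \in C -> (3 <= #|C|)%N ->
  (#|[set c : 'rV[F]_3 | [forall z in C, qnorm (z - c) == t]]| <= q)%N.
Proof.
move=> n0 n4 yC C3; apply: leq_trans (card_common_le oddF t yC) _.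
rewrite -[leqRHS]expn1 leq_exp2l ?(leq_trans _ q128) // leq_subLR.
rewrite addnC -[leqLHS]/(1 + 2)%N leq_add2l ltnNge; apply/negP => rk.
have [z1 [z2 [z1C z2C z12]]] : exists z1 z2, [/\ z1 \in C :\ y, z2 \in C :\ y & z1 != z2].
  have /card_gt1P[z1 [z2 [? ? ?]]] : (1 < #|C :\ y|)%N.
    by move: C3; rewrite (cardsD1 y) yC.
  by exists z1, z2.
move: z1C z2C; rewrite !in_setD1 => /andP[z1y z1C] /andP[z2y z2C].
have sub z : z \in C -> (z - y <= shift_span C y)%MS.
  by move=> zC; rewrite (sumsmx_sup z) ?genmxE.
have u0 : z1 - y != 0 by rewrite subr_eq0.
have span_u : (shift_span C y <= z1 - y)%MS.
  rewrite -(mxrank_leqif_sup (sub z1 z1C)) eqn_leq mxrankS ?sub //=.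
  by rewrite rank_rV u0.
have /sub_rVP[c e] := submx_trans (sub z2 z2C) span_u.
have c0 : c != 0.
  by apply: contraNneq z2y => c0; move: e; rewrite c0 scale0r => /eqP; rewrite subr_eq0.
have inS z : z \in C -> z \in sphere t a :&: sphere t b.
  by rewrite !inE !(qnormC z) => /andP[/andP[_ ->] /andP[_ ->]].
have c1 : c = 1.
  apply: (@sphereI_chord_inj F oddF a b y (z1 - y) t c) => //; first exact: inS.
    by rewrite addrC subrK inS.
  by rewrite -e addrC subrK inS.
by move/eqP: z12; apply; apply: (addIr (- y)); rewrite e c1 scale1r.
Qed.

Lemma VCdim_dimension_three : (2 ^ 12 * q ^ 2 <= N)%N ->
  (3 <= graph_VCdim (distance_graph E t))%N.
Proof.
move=> large.
have q0 : (0 < q)%N by apply: leq_trans q128.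
have N0 : (0 < N)%N by apply: leq_trans large; rewrite muln_gt0 !expn_gt0 q0.
have large100 : (100 * q ^ 2 <= N)%N.
  by apply: leq_trans large; rewrite leq_mul2r orbT.
have [_ edges] := pairs3_bounds oddF t large100.
pose I a b r : nat := (qnorm (a - b)%R == r).
pose P : rel 'rV[F]_3 := fun a b => [|| #|nbr E t a :&: nbr E t b| <= 2,
  qnorm (a - b)%R == 0%R | qnorm (a - b)%R == (4 * t)%R]%N.
have bad a b : (P a b * #|nbr E t a :&: nbr E t b| <=
   2 + (a == b) * (2 * q ^ 2) + 2 * q * (I a b 0%R + I a b (4 * t)%R))%N.
  rewrite /P /I; case: (leqP #|_| 2) => [h|_] /=.
    by rewrite mul1n -addnA; apply: leq_trans h (leq_addr _ _).
  have sub : nbr E t a :&: nbr E t b \subset sphere t a :&: sphere t b.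
    by apply/subsetP => z; rewrite !inE !(qnormC z) => /andP[/andP[_ ->] /andP[_ ->]].
  have [->|ab] := eqVneq a b.
    rewrite mul1n; apply: (@leq_trans (2 * q ^ 2)); last first.
      by rewrite addnAC; apply: leq_addl.
    apply: leq_trans (card_sphere_le oddF (leqnn 3) b t).
    apply: (@leq_trans #|nbr E t b :&: nbr E t b|); first by case: (_ || _); rewrite ?mul1n.
    rewrite setIid; apply/subset_leq_card/subsetP => z.
    by rewrite !inE qnormC => /andP[].
  have := leq_trans (subset_leq_card sub) (card_sphereI_le oddF (leqnn 3) t ab).
  rewrite /= expn1; move: #|_ :&: _| q.
  by case: (_ == 0); case: (_ == 4 * t) => /= c p; lia.
have [|y yE [deg_y smallP]] := @exists_center F 3 E t P edges.
  apply: (@leq_ltn_trans (1024 * q ^ 2 * (2 * N ^ 2 + N * (2 * q ^ 2) +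
     2 * q * (pairs E 0%R + pairs E (4 * t)%R)))).
    rewrite leq_mul2l; apply/orP; right.
    apply: (@leq_trans (\sum_(a in E) (2 * N + 2 * q ^ 2 +
       2 * q * (#|nbr E 0%R a| + #|nbr E (4 * t)%R a|)))%N); last first.
      rewrite big_split sum_nat_const -big_distrr big_split /=.
      by rewrite mulnDr (mulnCA N) mulnn.
    apply: leq_sum => a aE; apply: leq_trans (leq_sum _ (fun b _ => bad a b)) _.
    rewrite !big_split /= -big_distrl -big_distrr /= big_split sum_nat_const /=.
    rewrite !card_set_in_sum leq_add // leq_add ?(mulnC N) //.
    rewrite [X in (X * _)%N](_ : _ = 1%N) ?mul1n //.
    by rewrite (bigD1 a) //= eqxx big1 // => b /andP[_]; rewrite eq_sym => /negbTE->.
  have [P0 _] := pairs3_bounds oddF 0 large100.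
  have [P4 _] := pairs3_bounds oddF (4 * t) large100.
  (* 11 = 2 + 1 + 2 * (2 + 2), the last two summands from [pairs3_bounds] at the radii 0 and 4t.
     Then 1024 * 11 q^2 <= 11 N / 4 < 3 N. *)
  have inner : (2 * N ^ 2 + N * (2 * q ^ 2) + 2 * q * (pairs E 0%R + pairs E (4 * t)%R)
      <= 11 * N ^ 2)%N.
    have : (N * (2 * q ^ 2) <= N ^ 2)%N.
      rewrite -mulnn leq_mul2l; apply/orP; right.
      by apply: leq_trans large100; rewrite leq_mul2r orbT.
    rewrite -(mulnA 2) mulnDr; move: P0 P4.
    move: (q * pairs E 0%R)%N (q * pairs E (4 * t)%R)%N (N * (2 * q ^ 2))%N (N ^ 2)%N.
    by clear; lia.
  apply: leq_ltn_trans (leq_mul (leqnn _) inner) _.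
  rewrite -(ltn_pmul2l (_ : 0 < 4)%N) //.
  have -> : (4 * (1024 * q ^ 2 * (11 * N ^ 2)) = (2 ^ 12 * q ^ 2) * (11 * N ^ 2))%N.
    by rewrite (expnD 2 10 2) !mulnA (mulnC 4).
  apply: leq_ltn_trans (leq_mul large (leqnn _)) _.
  rewrite mulnCA -expnS mulnA ltn_mul2r expn_gt0 N0 //.
set n := #|nbr E t y| in deg_y smallP.
have n_large : (2 ^ 10 * q <= n)%N.
  rewrite -(leq_pmul2l (_ : 0 < 4 * q)%N) ?muln_gt0 ?q0 //.
  apply: leq_trans deg_y; apply: leq_trans large.
  rewrite (expnD 2 2 10) -(mulnn q); apply/eq_leq.
  by move: (2 ^ 10)%N q => a b; ring.
apply: (@VCdim_from_center F 3 E t P y yE smallP).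
(* [pairs_small] would require n of order q^(3/2), while n is only known to be of order q. Instead,
   the neighbours of a inside the neighbourhood of y lie on two spheres with distinct centres, as t
   != 0. *)
- apply: (@leq_trans (64 * (n * (2 * q)))%N).
    rewrite leq_mul2l /= -sum_nat_const; apply: leq_sum => a aX.
    have ya : y != a.
      apply: contraNneq t0 => ya; move: aX; rewrite ya !inE => /andP[_ /eqP<-].
      by rewrite subrr qnorm_dot /dot mul0mx mxE.
    have := card_sphereI_le oddF (leqnn 3) t ya; rewrite /= expn1; apply: leq_trans.
    apply/subset_leq_card/subsetP => z; rewrite !inE !(qnormC z).
    by move=> /andP[/andP[_ ->] ->].
  rewrite -mulnn mulnCA leq_mul2l; apply/orP; right; apply: leq_trans n_large.
  by rewrite mulnA leq_mul2r orbT.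
- apply: high_degree_small => //.
  apply: (@leq_trans ((2 ^ 12 * q ^ 2) ^ 2)); last by rewrite leq_sqr.
  rewrite expnMn -!expnM; apply: leq_mul; last exact: leqnn.
  by rewrite leq_pexp2l.
- apply: leq_trans n_large; apply: (@leq_trans (2 ^ 10 * 1)) => //.
  by rewrite leq_mul2l q0 orbT.
move=> a b aX bX; rewrite /P !negb_or -ltnNge => /and3P[codeg n0 n4].
have yC : y \in nbr E t a :&: nbr E t b by rewrite inE (nbrC yE aX) (nbrC yE bX).
apply: leq_trans (leq_mul (leqnn 6) (card_common3_le n0 n4 yC codeg)) _.
by apply: leq_trans n_large; rewrite leq_mul2r orbT.
Qed.

End DimensionThree.

(** * The exponent, the constant and the two cases *)

Lemma ceil_two_thirds (R : realType) (d : nat) :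
  Num.ceil (2 * d%:R / 3 : R) = ((2 * d + 2) %/ 3)%N%:Z.
Proof.
set s := ((2 * d + 2) %/ 3)%N.
have s_lt : ((s * 3)%:R : R) < (2 * d + 3)%:R.
  by rewrite ltr_nat /s; lia.
have s_ge : ((2 * d)%:R : R) <= (s * 3)%:R by rewrite ler_nat /s; lia.
apply: ceil_def; rewrite intrB -!pmulrn.
move: s_lt s_ge; rewrite !natrD !natrM => s_lt s_ge; apply/andP; split; lra.
Qed.

Theorem corollary1p6 (R : realType) (d : nat) (hd : (3 <= d)%N) :
  exists C : R, 0 < C /\
    forall (F : finFieldType) (t : F) (E : {set 'rV[F]_d}),
      odd #|F| -> t != 0 ->
      C * #|F|%:R ^ Num.ceil (2 * d%:R / 3 : R) < #|E|%:R ->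
      (3 <= graph_VCdim (distance_graph E t))%N.
Proof.
(* 2^12 is the factor used in both cases; 128^d makes the hypothesis fail for q < 128, where |E| <=
   q^d. *)
exists (2 ^ 12 * 128 ^ d)%N%:R; split.
  by rewrite ltr0n muln_gt0 !expn_gt0.
move=> F t E oddF t0; rewrite ceil_two_thirds; set s := (_ %/ 3)%N.
rewrite -exprnP -natrX -natrM ltr_nat => large.
have q0 : (0 < #|F|)%N := ltnW (card_finNzRing_gt1 F).
have q128 : (128 <= #|F|)%N.
  rewrite leqNgt; apply/negP => small; move: large; apply/negP; rewrite -leqNgt.
  apply: leq_trans (max_card _) _; rewrite card_mx mul1n.
  apply: (@leq_trans (1 * 128 ^ d * 1)%N).
    by rewrite mul1n muln1 leq_exp2r ?(ltnW small) // (leq_trans _ hd).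
  by rewrite !leq_mul ?expn_gt0 ?q0.
have {}large : (2 ^ 12 * #|F| ^ s <= #|E|)%N.
  apply: leq_trans (ltnW large); rewrite leq_mul2r leq_pmulr ?orbT //.
  by rewrite expn_gt0.
(* For d = 3 the exponent is s = 2 and 2s = d + 1; from d = 4 on, 2s >= d + 2. *)
have [d3|d4] := eqVneq d 3%N.
  move: E large; rewrite /s d3 => E large; exact: VCdim_dimension_three.
apply: (@VCdim_large_dimension F d s) => //; rewrite /s; lia.
Qed.
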